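(* Let $\Gamma$ be a graph on a set $V$ of $k$ vertices, with a combined voltage assignment $(\alpha,\omega)$ in a finite group $G$ that assigns a subgroup $G_v$ of $G$ to every vertex $v\in V$, and let $k^\omega=\sum_{v\in V}[G:G_v]$ be the number of vertices of the factored lift $\Gamma^{(\alpha,\omega)}$. Let $\rho$ be a complex irreducible representation of $G$ of dimension $d\ge 1$ and let $\mathbf{B}(\rho)$ be the associated complex $dk\times dk$ block matrix with $d\times d$ blocks $$\mathbf{B}_{u,v}(\rho)=\sum_{a\in\overrightarrow{uv}}\ \sum_{h\in G_u}\rho(h\alpha(a)),\qquad u,v\in V.$$ Let $\mathbf{f}$ be a $dk$-dimensional (column) eigenvector of $\mathbf{B}(\rho)$ for some complex eigenvalue $\lambda$ of $\mathbf{B}(\rho)$, with $d$-segments $\mathbf{f}(v)\in\mathbb{C}^d$ for $v\in V$, which fulfils the following condition $\mathbf{(C)}$: for every $v\in V$, $\mathbf{f}(v)\ne\mathbf{0}$ implies that $\rho(h)\mathbf{f}(v)=\mathbf{c}_v$ for every $h\in G_v$, where $\mathbf{c}_v\in\mathbb{C}^d$ may depend on $v$ but not on $h\in G_v$. Then: (i) The $dk^\omega$-dimensional vector $\mathbf{f}^+$ with $k^\omega$ $d$-segments indexed by the $k^\omega$ ordered pairs $(v,hG_v)$ for $v\in V$ and $hG_v\in G/G_v$, given by $\mathbf{f}^+(v,hG_v)=\rho(h)\mathbf{f}(v)$, is well defined and does not depend on representatives of cosets in $G/G_v$. (ii) For every $j\in\{1,\dots,d\}$ the $j$-section $\mathbf{f}^+_{[j]}$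 of $\mathbf{f}^+$ is a $k^\omega$-dimensional eigenvector of the factored lift $\Gamma^{(\alpha,\omega)}$ for the same eigenvalue $\lambda$. (iii) Let $S$ be the system of $k^\omega$ linear equations of the form $\mathbf{c}\,\rho(h)\mathbf{f}(v)=0$ for $v\in V$ and $hG_v\in G/G_v$, for an unknown row vector $\mathbf{c}=(c_1,c_2,\ldots,c_d)$ of dimension $d$. The set of $j$-sections $\{\mathbf{f}^+_{[j]} : j\in\{1,\dots,d\}\}$ is linearly independent if and only if the system $S$ has only the trivial solution $\mathbf{c}=\mathbf{0}$. In particular, this is satisfied if $V$ contains a subset $U$ of $d$ vertices such that the $d$-segments $\mathbf{f}(u)$ for $u\in U$ are linearly independent.
   Context: Graphs are finite, undirected, and may have loops, semi-edges and parallel edges. They are described by a vertex set $V$ and an arc set $A$, where each arc $a$ has an initial and a terminal vertex and a reverse arc $a^-$ (with $(a^-)^-=a$; $a^-=a$ is allowed for a semi-edge), and $a^-$ goes from the terminal to the initial vertex of $a$. For $u,v\in V$ (not necessarily distinct), $\overrightarrow{uv}$ denotes the set of arcs from $u$ to $v$. A combined voltage assignment on $\Gamma$ in a finite group $G$ is a pair $(\alpha,\omega)$, where $\alpha:A\to G$ satisfies $\alpha(a^-)=\alpha(a)^{-1}$ for every arc $a$, and $\omega$ assigns to every vertex $u\in V$ a subgroup $\omega(u)=G_u$ of $G$. The factored lift $\Gamma^{(\alpha,\omega)}$ is the graph whose vertices are all pairs $(u,H)$ with $u\in V$ and $H\in G/G_u=\{hG_u : h\in G\}$ (left cosets), and whose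 arcs are all pairs $(a,h)$ with $a\in A$ and $h\in G$; if $a\in\overrightarrow{uv}$, the arc $(a,h)$ goes from $(u,hG_u)$ to $(v,h\alpha(a)G_v)$. Distinct pairs $(a,h)$ are distinct arcs (so parallel arcs may occur). The reverse of the arc $(a,h)$ is $(a^-,h\alpha(a))$. Eigenvalues and eigenvectors of a graph are those of its adjacency matrix, whose $(x,y)$-entry is the number of arcs from $x$ to $y$. The representation $\rho$ is a homomorphism from $G$ to the group of invertible complex $d\times d$ matrices. The block $\mathbf{B}_{u,v}(\rho)$ is the zero matrix if $\overrightarrow{uv}=\emptyset$. A column vector of dimension $d\ell$ is viewed as a sequence of $\ell$ consecutive $d$-dimensional column vectors, called its $d$-segments; for $\mathbf{f}$ of dimension $dk$ the $d$-segments $\mathbf{f}(v)$ are indexed by $v\in V$ consistently with the blocks of $\mathbf{B}(\rho)$. For $j\in\{1,\dots,d\}$, the $j$-section of a $d\ell$-dimensional vector is the $\ell$-dimensional column vector formed by the $j$-th coordinates of its $d$-segments; thus the $(v,hG_v)$-coordinate of $\mathbf{f}^+_{[j]}$ is the $j$-th coordinate of $\mathbf{f}^+(v,hG_v)$. *)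

(* Defs.v *)
From HB Require Import structures.
From mathcomp Require Import all_boot all_order all_fingroup all_algebra all_character.

Set Implicit Arguments.
Unset Strict Implicit.
Unset Printing Implicit Defensive.

Import GroupScope GRing.Theory.
Local Open Scope ring_scope.

(* A fixed arc [grev a = a] is a semi-edge (it then starts and ends at the same
   vertex); loops and parallel edges are unrestricted. *)
Record graph := Graph {
  gvert : finType;
  garc : finType;
  gini : garc -> gvert;
  gter : garc -> gvert;
  grev : garc -> garc;
  grevK : involutive grev;
  gini_rev : forall a, gini (grev a) = gter a;
  gter_rev : forall a, gter (grev a) = gini a
}.

Definition arcs_between (Gam : graph) (u v : gvert Gam) : {set garc Gam} :=
  [set a | (gini a == u) && (gter a == v)].

Definition adjacency_mx (F : fieldType) (Gam : graph) : 'M[F]_#|gvert Gam| :=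
  \matrix_(i, j) #|arcs_between (enum_val i) (enum_val j)|%:R.

Definition is_eigenvector (F : fieldType) (n : nat) (M : 'M[F]_n) (lambda : F)
    (x : 'cV[F]_n) : Prop :=
  x != 0 /\ M *m x = lambda *: x.

Record voltage (Gam : graph) (gT : finGroupType) := Voltage {
  valpha : garc Gam -> gT;
  vomega : gvert Gam -> {group gT};
  valpha_rev : forall a, valpha (grev a) = ((valpha a)^-1)%g
}.

Section FactoredLift.

Variables (Gam : graph) (gT : finGroupType) (vo : voltage Gam gT).

Definition lift_vert : finType :=
  {x : gvert Gam * {set gT} | x.2 \in lcosets (vomega vo x.1) [set: gT]}.

Lemma lift_vertex_subproof (u : gvert Gam) (h : gT) :
  (h *: vomega vo u)%g \in lcosets (vomega vo u) [set: gT].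
Proof. by apply/lcosetsP; exists h. Qed.

Definition lift_vertex (u : gvert Gam) (h : gT) : lift_vert :=
  exist _ (u, (h *: vomega vo u)%g) (lift_vertex_subproof u h).

Definition lift_arc : finType := (garc Gam * gT)%type.

Definition lift_ini (x : lift_arc) : lift_vert := lift_vertex (gini x.1) x.2.

Definition lift_ter (x : lift_arc) : lift_vert :=
  lift_vertex (gter x.1) (x.2 * valpha vo x.1)%g.

Definition lift_rev (x : lift_arc) : lift_arc :=
  (grev x.1, (x.2 * valpha vo x.1)%g).

Lemma lift_revK : involutive lift_rev.
Proof. by case=> a h; rewrite /lift_rev /= grevK valpha_rev mulgK. Qed.

Lemma lift_ini_rev x : lift_ini (lift_rev x) = lift_ter x.
Proof. by rewrite /lift_ini /lift_ter /= gini_rev. Qed.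

Lemma lift_ter_rev x : lift_ter (lift_rev x) = lift_ini x.
Proof. by rewrite /lift_ini /lift_ter /= gter_rev valpha_rev mulgK. Qed.

Definition factored_lift : graph :=
  Graph lift_revK lift_ini_rev lift_ter_rev.

Lemma card_lift_vert :
  #|gvert factored_lift| = (\sum_(v : gvert Gam) #|[set: gT] : vomega vo v|)%N.
Proof.
rewrite /= card_sig -sum1_card.
rewrite (eq_bigl (fun x : gvert Gam * {set gT} =>
  xpredT x.1 && (x.2 \in lcosets (vomega vo x.1) [set: gT]))) //.
rewrite -(pair_big_dep xpredT
  (fun u (H : {set gT}) => H \in lcosets (vomega vo u) [set: gT])
  (fun _ _ => 1%N)).
by apply: eq_bigr => u _; rewrite sum1_card card_lcosets.
Qed.

End FactoredLift.

(* Vectors made of d-segments indexed by a finite type [T] are block columns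
   with #|T| blocks of height d, in the order given by [enum T]; this is also
   the order of the blocks of [rep_block_mx]. *)
Notation "''segV[' F ]_ ( T , d )" := 'cV[F]_(\sum_(i < #|T|) d)
  (at level 8, F at level 2, T, d at level 9) : type_scope.

Definition segment (F : fieldType) (T : finType) (d : nat)
    (x : 'segV[F]_(T, d)) (t : T) : 'cV[F]_d :=
  submxcol (p_ := fun=> d) x (enum_rank t).

Definition section (F : fieldType) (T : finType) (d : nat)
    (x : 'segV[F]_(T, d)) (j : 'I_d) : 'cV[F]_#|T| :=
  \col_(i < #|T|) segment x (enum_val i) j 0.

Section Representation.

Variables (F : fieldType) (Gam : graph) (gT : finGroupType).
Variables (vo : voltage Gam gT) (d : nat).
Variable rho : mx_representation F [set: gT]%G d.

Definition rep_block (u v : gvert Gam) : 'M[F]_d :=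
  \sum_(a in arcs_between u v) \sum_(h in vomega vo u) rho (h * valpha vo a)%g.

Definition rep_block_mx : 'M[F]_(\sum_(i < #|gvert Gam|) d) :=
  \mxblock_(i < #|gvert Gam|, j < #|gvert Gam|)
    rep_block (enum_val i) (enum_val j).

Variable f : 'segV[F]_(gvert Gam, d).

Definition condition_C : Prop :=
  forall v, segment f v != 0 ->
    exists c : 'cV[F]_d, forall h, h \in vomega vo v -> rho h *m segment f v = c.

Definition is_lifted_vector
    (fp : 'segV[F]_(gvert (factored_lift vo), d)) : Prop :=
  forall v h, segment fp (lift_vertex vo v h) = rho h *m segment f v.

(* The left-hand side depends only on the coset [h *: G_v] when condition (C)
   holds, so that this is one equation for each vertex of the factored lift. *)
Definition only_trivial_solution : Prop :=
  forall c : 'rV[F]_d,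
    (forall v h, c *m rho h *m segment f v = 0) -> c = 0.

End Representation.

Arguments is_lifted_vector {F Gam gT} vo {d} rho f fp.

(* Main.v *)
Require Import Defs.
From mathcomp Require Import all_boot all_order all_fingroup all_algebra all_character.
From mathcomp Require Import reals complex.

Set Implicit Arguments.
Unset Strict Implicit.
Unset Printing Implicit Defensive.

Import GroupScope GRing.Theory.
Local Open Scope ring_scope.

(* The neighbours of (u, h G_u) in the factored lift are reached by the arcs (a, h g)
   with g in G_u, so summing f^+ over them gives rho(h) (B f)(u), which is
   lambda f^+(u, h G_u). Since rho is irreducible, the rows c rho(h) span the whole
   space as soon as c is nonzero; hence c rho(h) f(v) = 0 for all v and h forces
   c = 0 or f = 0, which yields both the independence of the sections and, as a
   consequence, their non-vanishing. *)

Lemma segmentP (F : fieldType) (T : finType) (d : nat) (x y : 'segV[F]_(T, d)) :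
  (forall t, segment x t = segment y t) -> x = y.
Proof.
move=> exy; apply/mxcolP => i.
by have := exy (enum_val i); rewrite /segment enum_valK.
Qed.

Lemma segment_neq0 (F : fieldType) (T : finType) (d : nat) (x : 'segV[F]_(T, d)) :
  x != 0 -> exists t, segment x t != 0.
Proof.
move=> x0; apply/existsP; apply: contraNT x0 => /existsPn x0.
apply/eqP/segmentP => t; rewrite [RHS]submxcol0.
by apply/eqP; have := x0 t; rewrite negbK.
Qed.

Lemma sectionE (F : fieldType) (T : finType) (d : nat) (x : 'segV[F]_(T, d)) j t :
  section x j (enum_rank t) 0 = segment x t j 0.
Proof. by rewrite mxE enum_rankK. Qed.

(** Grouping the arcs that leave [u] by their terminal vertex gives classes whose sizes are the
    entries of row [u] of the adjacency matrix. *)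
Lemma mulmx_adjacency (F : fieldType) (Gam : graph) (x : 'cV[F]_#|gvert Gam|) u :
  (adjacency_mx F Gam *m x) (enum_rank u) 0 =
  \sum_(a | gini a == u) x (enum_rank (gter a)) 0.
Proof.
rewrite mxE (partition_big (fun a => enum_rank (gter a)) predT) //=.
apply: eq_bigr => j _; rewrite mxE enum_rankK mulr_natl -sumr_const.
apply: eq_big => [a | a]; rewrite inE.
  by rewrite -(inj_eq enum_rank_inj (gter a)) enum_valK.
by case/andP=> _ /eqP->; rewrite enum_valK.
Qed.

Lemma sum_arcs_between (V : nmodType) (Gam : graph) u (E : garc Gam -> V) :
  \sum_v \sum_(a in arcs_between u v) E a = \sum_(a | gini a == u) E a.
Proof.
rewrite [RHS](partition_big (@gter Gam) predT) //.
by apply: eq_bigr => v _; apply: eq_bigl => a; rewrite inE.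
Qed.

Lemma lift_vertexP (Gam : graph) (gT : finGroupType) (vo : voltage Gam gT)
    (x : lift_vert vo) :
  exists u h, x = lift_vertex vo u h.
Proof.
case: x => [[u H] Hx]; have /lcosetsP[h _ /= eH] := Hx.
by exists u, h; apply: val_inj; rewrite /= eH.
Qed.

(** A lift arc [(a, g')] starts at the given vertex exactly when [a] starts at [u] and [g'] lies in
    the coset of [h]; left translation by [h] then parametrises that coset by the subgroup at
    [u]. *)
Lemma sum_lift_arcs (V : nmodType) (Gam : graph) (gT : finGroupType)
    (vo : voltage Gam gT) u h (E : garc Gam -> gT -> V) :
  \sum_(b : lift_arc Gam gT | lift_ini vo b == lift_vertex vo u h) E b.1 b.2 =
  \sum_(a | gini a == u) \sum_(g in vomega vo u) E a (h * g)%g.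
Proof.
rewrite (eq_bigl (fun b => (gini b.1 == u) && (b.2 \in h *: vomega vo u)%g)).
  rewrite -(pair_big (fun a => gini a == u) (fun g => g \in h *: vomega vo u)%g) /=.
  apply: eq_bigr => a _; rewrite (reindex_inj (mulgI h)) /=.
  by apply: eq_bigl => g; rewrite mem_lcoset mulKg.
case=> a g; rewrite -val_eqE /= xpair_eqE.
by case: eqP => //= ->; apply/eqP/idP => /lcoset_eqP.
Qed.

Section Lifting.

Variables (F : fieldType) (Gam : graph) (gT : finGroupType).
Variables (vo : voltage Gam gT) (d : nat).
Variable rho : mx_representation F [set: gT]%G d.
Variable f : 'segV[F]_(gvert Gam, d).

Lemma segment_rep_block_mx u :
  segment (rep_block_mx vo rho *m f) u =
  \sum_(a | gini a == u) \sum_(g in vomega vo u)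
    rho (g * valpha vo a)%g *m segment f (gter a).
Proof.
rewrite -sum_arcs_between /segment -{1}(submxcolK f) /rep_block_mx mxblockEv.
rewrite mxcol_mul mxcolK mul_mxrow_mxcol enum_rankK.
(* The block index runs over ordinals; [enum_rank] turns it back into a vertex. *)
rewrite (reindex _ (onW_bij _ (enum_rank_bij (gvert Gam)))) /=.
apply: eq_bigr => v _; rewrite enum_rankK mulmx_suml; apply: eq_bigr => a.
by rewrite inE => /andP[_ /eqP->]; exact: mulmx_suml.
Qed.

(** Taking the identity in condition (C) shows that the constant vector is the segment itself, so a
    nonzero segment is fixed by the subgroup at [v]; a zero segment is fixed trivially. *)
Lemma condition_C_fix v h : condition_C vo rho f -> h \in vomega vo v ->
  rho h *m segment f v = segment f v.
Proof.
have [-> | nz C Gh] := eqVneq (segment f v) 0; first by rewrite mulmx0.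
have [c Cc] := C v nz.
by rewrite Cc // -(Cc 1%g) // repr_mx1 mul1mx.
Qed.

Lemma condition_C_lcoset v h h' : condition_C vo rho f ->
  (h *: vomega vo v = h' *: vomega vo v)%g ->
  rho h *m segment f v = rho h' *m segment f v.
Proof.
move=> C /lcoset_eqP/lcosetP[g Gg ->].
by rewrite repr_mxM ?inE // -mulmxA condition_C_fix.
Qed.

Lemma lifted_vector_exists_unique : condition_C vo rho f ->
  exists! fp, is_lifted_vector vo rho f fp.
Proof.
move=> C.
(* Each coset contributes the value at its chosen element [repr], which lies in the coset and so may
   be exchanged for any other representative. *)
pose fp : 'segV[F]_(gvert (factored_lift vo), d) :=
  \mxcol_i (rho (repr (val (enum_val i)).2) *m segment f (val (enum_val i)).1).
exists fp; split=> [v h | fq fqP].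
  rewrite /segment mxcolK enum_rankK; apply: condition_C_lcoset => //.
  exact/lcoset_eqP/mem_repr/lcoset_refl.
apply: segmentP => x; have [v [h ->]] := lift_vertexP x; rewrite fqP.
rewrite /segment mxcolK enum_rankK; apply: condition_C_lcoset => //.
exact/lcoset_eqP/mem_repr/lcoset_refl.
Qed.

Variable fp : 'segV[F]_(gvert (factored_lift vo), d).
Hypothesis fpP : is_lifted_vector vo rho f fp.

Lemma section_lift_eigen lambda j :
  rep_block_mx vo rho *m f = lambda *: f ->
  adjacency_mx F (factored_lift vo) *m section fp j = lambda *: section fp j.
Proof.
move=> Bf; apply/colP => i; rewrite -(enum_valK i).
have [u [h ->]] := lift_vertexP (enum_val i).
rewrite mulmx_adjacency [RHS]mxE sectionE fpP.
(* Both sides meet at coordinate [j] of [rho h] applied to segment [u] of the product: the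
   eigenvector equation rewrites it as the right side, expanding the product as the left. *)
transitivity ((rho h *m segment (rep_block_mx vo rho *m f) u) j 0); last first.
  rewrite Bf (_ : segment _ u = lambda *: segment f u) -?scalemxAr ?[LHS]mxE //.
  by apply/colP => k; rewrite !mxE.
rewrite segment_rep_block_mx mulmx_sumr summxE.
rewrite (eq_bigr (fun b : lift_arc Gam gT =>
  (rho (b.2 * valpha vo b.1)%g *m segment f (gter b.1)) j 0)); last first.
  by move=> b _; rewrite sectionE fpP.
rewrite (sum_lift_arcs vo u h
  (fun a g => (rho (g * valpha vo a)%g *m segment f (gter a)) j 0)).
apply: eq_bigr => a _; rewrite mulmx_sumr summxE; apply: eq_bigr => g _.
by rewrite mulmxA -repr_mxM ?inE // mulgA.
Qed.

(** At the vertex given by [v] and [h], the combination of the sections with coefficients [c] has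
    the scalar [c *m rho h *m segment f v] as its coordinate. Linear relations among the sections
    are thus the solutions of the system. *)
Lemma sum_sections_eq0 (c : 'rV[F]_d) :
  \sum_j c 0 j *: section fp j = 0 <->
  (forall v h, c *m rho h *m segment f v = 0).
Proof.
have E v h : (\sum_j c 0 j *: section fp j) (enum_rank (lift_vertex vo v h)) 0 =
    (c *m rho h *m segment f v) 0 0.
  rewrite summxE -mulmxA -fpP [RHS]mxE; apply: eq_bigr => j _.
  by rewrite mxE sectionE.
split=> [s0 v h | c0].
  by apply/colP => i; rewrite ord1 -E s0 !mxE.
apply/colP => i; rewrite -(enum_valK i).
by have [u [h ->]] := lift_vertexP (enum_val i); rewrite E c0 !mxE.
Qed.

Lemma free_sections :
  free [seq section fp j | j <- enum 'I_d] <-> only_trivial_solution rho f.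
Proof.
have sz : size [seq section fp j | j <- enum 'I_d] == d.
  by rewrite size_map size_enum_ord.
have nthE (k : 'I_d -> F) : \sum_(i < d) k i *: (Tuple sz)`_i =
    \sum_j (\row_i k i) 0 j *: section fp j.
  apply: eq_bigr => j _.
  by rewrite (nth_map j) ?size_enum_ord // nth_ord_enum mxE.
split=> [/(@freeP _ _ _ (Tuple sz)) fr c /sum_sections_eq0 c0 | triv].
  apply/rowP => j; rewrite mxE; apply: (fr (fun i => c 0 i)).
  by rewrite nthE -[RHS]c0; apply: eq_bigr => i _; rewrite mxE.
apply/(@freeP _ _ _ (Tuple sz)) => k; rewrite nthE => /sum_sections_eq0/triv k0 i.
by have /rowP/(_ i) := k0; rewrite !mxE.
Qed.

End Lifting.

Lemma irr_row_vanish (F : fieldType) (gT : finGroupType) (G : {group gT}) (d : nat)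
    (rho : mx_representation F G d) (c : 'rV[F]_d) (x : 'cV[F]_d) :
  mx_irreducible rho -> c != 0 ->
  (forall h, h \in G -> c *m rho h *m x = 0) -> x = 0.
Proof.
move=> irr c0 cx0; apply/row_matrixP => i; rewrite row0 rowE.
have : ((delta_mx 0 i : 'rV_d) <= cyclic_mx rho c)%MS.
  (* The submodule generated by the nonzero row [c] is everything, so each basis row is [c] times an
     element of the enveloping algebra, that is, a combination of rows [c *m rho h]. *)
  by rewrite -(mxsimple_cyclic irr c0 (submx1 _)) submx1.
case/cyclic_mxP => _ /envelop_mxP[a ->] ->.
rewrite mulmx_sumr mulmx_suml big1 // => h Gh.
by rewrite -scalemxAr -scalemxAl cx0 ?scaler0.
Qed.

Theorem theorem4p2 (R : realType) (Gam : graph) (gT : finGroupType)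
    (vo : voltage Gam gT) (d : nat) (hd : (0 < d)%N)
    (rho : mx_representation R[i] [set: gT]%G d)
    (hrho : mx_irreducible rho)
    (lambda : R[i]) (f : 'segV[R[i]]_(gvert Gam, d))
    (hf : is_eigenvector (rep_block_mx vo rho) lambda f)
    (hC : condition_C vo rho f) :
  [/\ (* (i) *)
      (forall (v : gvert Gam) (h h' : gT),
          (h *: vomega vo v = h' *: vomega vo v)%g ->
          rho h *m segment f v = rho h' *m segment f v)
      /\ (exists! fp, is_lifted_vector vo rho f fp),
      (* (ii) *)
      forall fp, is_lifted_vector vo rho f fp ->
        forall j : 'I_d,
          is_eigenvector (adjacency_mx R[i] (factored_lift vo)) lambda
            (section fp j)
    & (* (iii) *)
      forall fp, is_lifted_vector vo rho f fp ->
        (free [seq section fp j | j <- enum 'I_d] <->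
           only_trivial_solution rho f)
        /\ (forall U : {set gvert Gam}, #|U| = d ->
              free [seq segment f u | u <- enum U] ->
              only_trivial_solution rho f
              /\ free [seq section fp j | j <- enum 'I_d])].

Proof.
have [f_neq0 Bf] := hf; have [v fv_neq0] := segment_neq0 f_neq0.
have triv : only_trivial_solution rho f.
  move=> c c0; apply/eqP; apply: contraNT fv_neq0 => c_neq0.
  by apply/eqP/(irr_row_vanish hrho c_neq0) => h _; apply: c0.
split; first split.
- by move=> u h h'; apply: condition_C_lcoset.
- exact: lifted_vector_exists_unique.
- move=> fp fpP j; split; last exact: (section_lift_eigen fpP).
  (* A free family contains no zero vector, so every section is nonzero. *)
  have /(free_sections fpP)/free_not0 := triv; apply.
  by apply: map_f; rewrite mem_enum.
- move=> fp fpP; have fr := free_sections fpP.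
  by split=> // U _ _; split=> //; apply/fr.
Qed.
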